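(* Let $K$ be a field, $S=K[x_1,\ldots,x_n]$, and let $I=I_{d;a_1,\ldots,a_n}\subset S$ be an ideal of Veronese type satisfying $$d<\sum_{i=1}^n a_i,\qquad d>1,\qquad a_1,\ldots,a_n\geq1.$$ Then $\operatorname{Ass}^{\infty}(I)=V^*(I)$.
   Context: For a positive integer $d$ and non-negative integers $a_1,\ldots,a_n$ with $a_1+\cdots+a_n\ge d$, the ideal of Veronese type $I_{d;a_1,\ldots,a_n}\subset S$ is the monomial ideal generated by all monomials $x_1^{u(1)}\cdots x_n^{u(n)}$ with $u(1)+\cdots+u(n)=d$ and $0\le u(i)\le a_i$ for all $i$. $V^*(I)$ is the set of monomial prime ideals (ideals generated by variables) containing $I$. $\operatorname{Ass}(J)$ denotes the set of associated prime ideals of $S/J$, and $\operatorname{Ass}^\infty(I)$ is the stable value of $\operatorname{Ass}(I^k)$ for $k\gg0$ (which exists by Brodmann). *)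

(* Defs.v *)
From mathcomp Require Import all_boot all_order all_algebra.
From mathcomp Require Import ring_quotient classical_sets.
From mathcomp Require Import mpoly.

Set Implicit Arguments.
Unset Strict Implicit.
Unset Printing Implicit Defensive.

Import GRing.Theory.

Local Open Scope classical_set_scope.
Local Open Scope ring_scope.

Section Ideals.
Variable R : comNzRingType.
Implicit Types (G I J P : set R) (k : nat).

Definition ideal_gen G : set R :=
  [set f | exists s : seq (R * R),
     (forall p, p \in s -> G p.2) /\ f = \sum_(p <- s) p.1 * p.2].

(* For k = 0 the only generator is the empty product, so this is all of R. *)
Definition ideal_pow I k : set R :=
  ideal_gen [set g | exists f : 'I_k -> R,
     (forall i, I (f i)) /\ g = \prod_(i < k) f i].

(* [idealr_closed] already requires 1 \notin P. *)
Definition prime_ideal P : Prop :=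
  idealr_closed [pred f | f \in P] /\ prime_idealr_closed [pred f | f \in P].

(* The annihilator of the class of f in R / J is the colon ideal (J : f). *)
Definition colon J (f : R) : set R := [set g | J (g * f)].

Definition Ass J : set (set R) :=
  [set P | prime_ideal P /\ exists f, P = colon J f].

(* By Brodmann's theorem a stable value exists when R is noetherian; as for a
   limit, the notion is rendered as a relation, which carries its existence. *)
Definition is_Ass_infty I (A : set (set R)) : Prop :=
  exists k0, forall k, (k0 <= k)%N -> Ass (ideal_pow I k) = A.

End Ideals.

Section MonomialIdeals.
Variables (K : fieldType) (n : nat).

Definition var_ideal (A : {set 'I_n}) : set {mpoly K[n]} :=
  ideal_gen [set f | exists2 i, i \in A & f = 'X_i].

Definition Vstar (I : set {mpoly K[n]}) : set (set {mpoly K[n]}) :=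
  [set P | (exists A, P = var_ideal A) /\ I `<=` P].

Definition veronese_type (d : nat) (a : 'I_n -> nat) : set {mpoly K[n]} :=
  ideal_gen [set f | exists u : 'X_{1..n},
     [/\ mdeg u = d, forall i, (u i <= a i)%N & f = 'X_[u]]].

End MonomialIdeals.

Arguments veronese_type K {n} d a.

(* Main.v *)
(** The power [I^k] is the Veronese type ideal [I_{kd; k a}]: a monomial [x^m]
    lies in it iff [kd <= sum_i min (m_i, k a_i)].  Hence [I] is contained in the
    prime [P_A] generated by the variables of [A] iff [sum_(i not in A) a_i < d],
    and then for [k > n] some monomial of degree [kd - 1], with exponent [k a_i]
    off [A] and at most [k a_i - 1] on [A], has annihilator [P_A] modulo [I^k].
    Conversely, if [P = (I^k : f)] is prime and [A] is the set of variables in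
    [P], replacing [f] by its product with the [x_i^(k a_i)], [i] not in [A], does
    not change the colon ideal, and a comparison of leading monomials shows that
    no polynomial in the remaining variables lies in [P]. *)

Require Import Defs.
From mathcomp Require Import all_boot all_order all_algebra.
From mathcomp Require Import classical_sets mpoly.
From mathcomp Require Import boolp zify.

Set Implicit Arguments.
Unset Strict Implicit.
Unset Printing Implicit Defensive.

Import GRing.Theory.

Local Open Scope classical_set_scope.
Local Open Scope ring_scope.

(** * Generated ideals, their powers, and primes *)

Section Ideals.
Variable R : comNzRingType.
Implicit Types (G I P : set R) (f g : R).

Lemma ideal_gen_mem G g : G g -> ideal_gen G g.
Proof.
move=> Gg; exists [:: (1, g)]; split; last by rewrite big_seq1 mul1r.
by move=> p; rewrite inE => /eqP ->.
Qed.

Lemma ideal_gen0 G : ideal_gen G 0.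
Proof. by exists [::]; split=> //; rewrite big_nil. Qed.

Lemma ideal_genD G f g : ideal_gen G f -> ideal_gen G g -> ideal_gen G (f + g).
Proof.
move=> [s [Gs ->]] [t [Gt ->]]; exists (s ++ t); split; last by rewrite big_cat.
by move=> p; rewrite mem_cat => /orP[/Gs|/Gt].
Qed.

Lemma ideal_genMl G c f : ideal_gen G f -> ideal_gen G (c * f).
Proof.
move=> [s [Gs ->]]; exists [seq (c * p.1, p.2) | p <- s]; split.
  by move=> _ /mapP[p /Gs Gp ->].
by rewrite big_map mulr_sumr; apply: eq_bigr => p _; rewrite mulrA.
Qed.

Lemma ideal_pow_exp I k f : I f -> ideal_pow I k (f ^+ k).
Proof.
move=> If; apply: ideal_gen_mem; exists (fun=> f); split=> //.
by rewrite prodr_const card_ord.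
Qed.

Lemma prime_idealP P : prime_ideal P <->
  [/\ P 0, ~ P 1, forall c f g, P f -> P g -> P (c * f + g)
    & forall f g, P (f * g) -> P f \/ P g].
Proof.
have inP x : (x \in [pred f | f \in P]) = `[< P x >] by [].
split=> [[[P0 P1 PD] PM]|[P0 P1 PD PM]].
  split.
  - by move: P0; rewrite inP => /asboolP.
  - by move=> HP1; move: P1; rewrite inP => /asboolP; apply.
  - move=> c f g /asboolP Pf /asboolP Pg; apply/asboolP; exact: (PD c f g).
  - by move=> f g /asboolP /(PM f g) /orP[] /asboolP; [left|right].
split; first split.
- by rewrite inP; apply/asboolP.
- by rewrite inP; apply/asboolP.
- move=> c f g /asboolP Pf /asboolP Pg; apply/asboolP; exact: PD.
- by move=> f g /asboolP /PM[] Pfg; apply/orP; [left|right]; apply/asboolP.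
Qed.

Lemma prime_ideal_exp P k f : prime_ideal P -> P (f ^+ k) -> P f.
Proof.
move=> /prime_idealP[P0 P1 PD PM]; elim: k => [/P1 //|k IHk].
by rewrite exprS => /PM[].
Qed.

End Ideals.

(** A discrete intermediate value property, which supplies every exponent vector built below: as
    long as the total is too small, some lower bound is below its upper bound and can be raised by
    one. *)
Lemma sum_interpolation n (l u : 'I_n -> nat) s :
  (forall i, l i <= u i)%N -> (\sum_i l i <= s <= \sum_i u i)%N ->
  exists m : 'X_{1..n}, (forall i, l i <= m i <= u i)%N /\ mdeg m = s.
Proof.
move=> le_lu /andP[/subnKC <-]; move: (s - _)%N => t.
elim: t => [|t IHt] in l le_lu *.
  move=> _; exists [multinom l i | i < n]; split.
    by move=> i; rewrite mnmE leqnn le_lu.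
  by rewrite mdegE addn0; apply: eq_bigr => i _; rewrite mnmE.
move=> le_s.
have [i lt_lu] : exists i, (l i < u i)%N.
  apply/existsP; apply: contraLR le_s; rewrite negb_exists => /forallP ge_lu.
  rewrite -ltnNge addnS ltnS; apply: leq_trans (leq_addr _ _).
  by apply: leq_sum => i _; rewrite leqNgt.
have sumE : (\sum_j (l j + (i == j)) = (\sum_j l j).+1)%N.
  rewrite big_split /= -addn1; congr (_ + _)%N.
  by rewrite (bigD1 i) //= eqxx big1 // => j; rewrite eq_sym => /negPf ->.
have [||m [lmu mdeg_m]] := IHt (fun j => l j + (i == j))%N.
- by move=> j; case: eqP => [<-|_]; rewrite ?addn1 ?addn0.
- by rewrite sumE addSnnS.
exists m; split=> [j|]; last by rewrite mdeg_m sumE addSnnS.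
by have /andP[lj ->] := lmu j; rewrite andbT (leq_trans _ lj) ?leq_addr.
Qed.

(** * Ideals spanned by monomials *)

Section MonomialSpans.
Variables (K : fieldType) (n : nat).
Implicit Types (U V W : pred 'X_{1..n}) (f g : {mpoly K[n]}).

(** When [mnm_up U] holds this is a monomial ideal, and membership becomes a test on exponents. *)
Definition mnm_span U : set {mpoly K[n]} := [set f | all U (msupp f)].

Definition mnm_up U := forall m c : 'X_{1..n}, U m -> U (m + c)%MM.

Lemma mnm_span0 U : mnm_span U 0.
Proof. by rewrite /mnm_span /= msupp0. Qed.

Lemma mnm_spanX U m : mnm_span U 'X_[m] <-> U m.
Proof. by rewrite /mnm_span /= msuppX /= andbT. Qed.

Lemma mnm_spanD U f g : mnm_span U f -> mnm_span U g -> mnm_span U (f + g).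
Proof.
move=> /allP Uf /allP Ug; apply/allP => m /msuppD_le.
by rewrite mem_cat => /orP[/Uf|/Ug].
Qed.

Lemma mnm_spanN U f : mnm_span U f -> mnm_span U (- f).
Proof. by rewrite /mnm_span /= (perm_all _ (msuppN f)). Qed.

Lemma mnm_span_sum U (T : Type) (r : seq T) (Q : pred T) F :
  (forall t, Q t -> mnm_span U (F t)) -> mnm_span U (\sum_(t <- r | Q t) F t).
Proof.
move=> UF; elim/big_ind: _ => //; first exact: mnm_span0.
exact: mnm_spanD.
Qed.

Lemma mnm_spanM U f g :
  (forall m c, m \in msupp f -> c \in msupp g -> U (m + c)%MM) ->
  mnm_span U (f * g).
Proof.
move=> UD; apply/allP => m /msuppM_le /allpairsP[[m1 m2] /= [m1f m2g ->]].
exact: UD.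
Qed.

Lemma mnm_spanMl U f g : mnm_up U -> mnm_span U f -> mnm_span U (g * f).
Proof.
by move=> upU /allP Uf; apply: mnm_spanM => m c _ /Uf /upU; rewrite addmC.
Qed.

Lemma ideal_gen_sub_span G U :
  mnm_up U -> G `<=` mnm_span U -> ideal_gen G `<=` mnm_span U.
Proof.
move=> upU GU _ [s [Gs ->]]; rewrite big_seq; apply: mnm_span_sum => p /Gs /GU.
exact: mnm_spanMl.
Qed.

Lemma span_sub_ideal_gen G U :
  (forall m, U m -> ideal_gen G 'X_[m]) -> mnm_span U `<=` ideal_gen G.
Proof.
move=> UG f /allP Uf; rewrite [f]mpolyE big_seq.
elim/big_ind: _ => [||m /Uf /UG]; [exact: ideal_gen0|exact: ideal_genD|].
by rewrite -mul_mpolyC; apply: ideal_genMl.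
Qed.

(* After discarding the terms of [g] in [U] and those of [f] in [V], the product
   of the leading monomials of what is left is the leading monomial of an element
   of the span of [W]. *)
Lemma mnm_span_prime U V W g f :
    (forall m c, m \in msupp g -> c \in msupp f -> W (m + c)%MM = U m || V c) ->
  mnm_span W (g * f) -> mnm_span U g \/ mnm_span V f.
Proof.
move=> WE Wgf.
pose part (S : pred 'X_{1..n}) (p : {mpoly K[n]}) :=
  \sum_(m <- msupp p | S m) p@_m *: 'X_[m].
have partE S p : p = part S p + part (predC S) p.
  by rewrite {1}[p]mpolyE (bigID S).
have part_supp S p m : m \in msupp (part S p) -> (m \in msupp p) && S m.
  move=> /msupp_sum_le /flatten_mapP[c].
  by rewrite mem_filter => /andP[Sc cp] /msuppZ_le; rewrite msuppX inE => /eqP->;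
     rewrite cp.
have part_span S p : mnm_span S (part S p).
  by apply/allP => m /part_supp /andP[].
have [g0|g_neq0] := eqVneq (part (predC U) g) 0.
  by left; rewrite (partE U g) g0 addr0.
have [f0|f_neq0] := eqVneq (part (predC V) f) 0.
  by right; rewrite (partE V f) f0 addr0.
have /andP[gm /= nUg] := part_supp _ _ _ (mlead_supp g_neq0).
have /andP[fc /= nVf] := part_supp _ _ _ (mlead_supp f_neq0).
have /allP/(_ (mlead (part (predC U) g * part (predC V) f))) :
    mnm_span W (part (predC U) g * part (predC V) f).
  (* The products discarded from [g * f] have all their terms in [W], by [WE]. *)
  suff -> : part (predC U) g * part (predC V) f =
      g * f - (part U g * f + part (predC U) g * part V f).
    apply/mnm_spanD/mnm_spanN/mnm_spanD => //; apply: mnm_spanM => m c.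
      by move=> /part_supp /andP[mg Um] cf; rewrite WE // Um.
    by move=> /part_supp /andP[mg _] /part_supp /andP[cf Vc]; rewrite WE // Vc orbT.
  have -> : g * f = part U g * f + part (predC U) g * f.
    by rewrite -mulrDl -partE.
  rewrite opprD addrACA subrr add0r -mulrBr; congr (_ * _).
  by rewrite {2}(partE V f) addrC addKr.
rewrite mlead_supp ?mulf_neq0 // mleadM // WE // => /(_ isT).
by rewrite (negPf nUg) (negPf nVf).
Qed.

End MonomialSpans.

Arguments mnm_span K {n} U.

Lemma lem1m n (i : 'I_n) (m : 'X_{1..n}) : (0 < m i)%N -> (U_(i) <= m)%MM.
Proof. by move=> mi; apply/mnm_lepP => j; rewrite mnm1E; case: eqP => [<-|]. Qed.

(** * Primes generated by variables *)

Section VariableIdeals.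
Variables (K : fieldType) (n : nat) (A : {set 'I_n}).

Definition meets (m : 'X_{1..n}) := [exists i in A, 0 < m i]%N.

Lemma meets_up : mnm_up meets.
Proof.
move=> m c /exists_inP[i iA mi]; apply/exists_inP; exists i => //.
by rewrite mnmDE addn_gt0 mi.
Qed.

Lemma meetsD m c : meets (m + c)%MM = meets m || meets c.
Proof.
apply/idP/orP => [/exists_inP[i iA]|[/meets_up //|]].
  by rewrite mnmDE addn_gt0 => /orP[mi|ci]; [left|right]; apply/exists_inP; exists i.
by rewrite addmC; apply: meets_up.
Qed.

Lemma var_idealE : var_ideal A = mnm_span K meets.
Proof.
apply/seteqP; split.
  apply: (ideal_gen_sub_span meets_up) => _ [i iA ->]; apply/mnm_spanX.
  by apply/exists_inP; exists i; rewrite // mnm1E eqxx.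
apply: span_sub_ideal_gen => m /exists_inP[i iA mi].
by rewrite -(submK (lem1m mi)) mpolyXD; apply/ideal_genMl/ideal_gen_mem; exists i.
Qed.

Lemma var_ideal_prime : prime_ideal (var_ideal A : set {mpoly K[n]}).
Proof.
rewrite var_idealE; apply/prime_idealP; split.
- exact: mnm_span0.
- by rewrite -mpolyX0 => /mnm_spanX /exists_inP[i _]; rewrite mnm0E.
- by move=> c f g Pf Pg; apply/mnm_spanD/Pg/mnm_spanMl/Pf/meets_up.
- by move=> f g; apply: mnm_span_prime => m c _ _; apply: meetsD.
Qed.

End VariableIdeals.

Lemma prime_idealXm (K : fieldType) n (P : set {mpoly K[n]}) (m : 'X_{1..n}) :
  prime_ideal P -> P 'X_[m] -> exists2 i, (0 < m i)%N & P 'X_i.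
Proof.
move=> primeP; rewrite mpolyXE_id.
elim/big_rec: _ => [|i q _ IHq].
  by have /prime_idealP[_ P1 _ _] := primeP.
have /prime_idealP[_ P1 _ PM] := primeP.
case/PM=> // Pi; exists i; last exact: prime_ideal_exp Pi.
by rewrite lt0n; apply/eqP => mi; apply: P1; rewrite mi expr0 in Pi.
Qed.

(** * Powers of ideals of Veronese type *)

Section VeronesePowers.
Variables (K : fieldType) (n d : nat) (a : 'I_n -> nat).

(** The sum is the largest degree of a divisor of $x^m$ whose exponents are at most $k a_i$. *)
Definition vero k (m : 'X_{1..n}) := (k * d <= \sum_i minn (m i) (k * a i))%N.

Lemma vero_up k : mnm_up (vero k).
Proof.
move=> m c /leq_trans; apply; apply: leq_sum => i _.
by rewrite mnmDE leq_min geq_minr (leq_trans (geq_minl _ _)) ?leq_addr.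
Qed.

Lemma veroS k m c : vero k m -> vero 1 c -> vero k.+1 (m + c)%MM.
Proof.
rewrite /vero => Vm Vc; rewrite mulSnr -[X in (_ + X)%N]mul1n.
apply: leq_trans (leq_add Vm Vc) _; rewrite -big_split /=.
by apply: leq_sum => i _; rewrite mnmDE; lia.
Qed.

Lemma veronese_sub : veronese_type K d a `<=` mnm_span K (vero 1).
Proof.
apply: (ideal_gen_sub_span (@vero_up 1)) => _ [u [deg_u le_ua ->]].
apply/mnm_spanX; rewrite /vero mul1n -deg_u mdegE.
by apply: leq_sum => i _; rewrite mul1n leq_min leqnn le_ua.
Qed.

(** Generators are split off one at a time. The factor [u] must satisfy $u_i \le a_i$, and also $u_i
    \ge v_i - k a_i$ so that the quotient fits the induction hypothesis. *)
Lemma mnm_decomposition k (v : 'X_{1..n}) :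
    (forall i, v i <= k * a i)%N -> mdeg v = (k * d)%N ->
  exists f : nat -> 'X_{1..n},
    (forall j, j < k -> mdeg (f j) = d /\ forall i, f j i <= a i)%N /\
    'X_[v] = \prod_(j < k) 'X_[f j] :> {mpoly K[n]}.
Proof.
elim: k => [|k IHk] in v *.
  move=> _ /eqP; rewrite mdeg_eq0 => /eqP ->; exists (fun=> 0%MM); split=> //.
  by rewrite big_ord0 mpolyX0.
move=> le_va deg_v.
have [||u [lub deg_u]] :=
    @sum_interpolation n (fun i => v i - k * a i)%N (fun i => minn (v i) (a i)) d.
- by move=> i; have := le_va i; rewrite mulSn; lia.
(* After scaling by $k+1$ both bounds hold termwise, since $v_i \le (k+1) a_i$. *)
- apply/andP; split; rewrite -(leq_pmul2l (ltn0Sn k)) -deg_v mdegE big_distrr /=.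
    by apply: leq_sum => i _; have := le_va i; nia.
  by apply: leq_sum => i _; have := le_va i; nia.
have le_uv : (u <= v)%MM by apply/mnm_lepP => i; have := lub i; lia.
have vE := esym (submK le_uv).
have [||f [f_gen fE]] := IHk (v - u)%MM.
- by move=> i; rewrite mnmBE; have := lub i; have := le_va i; lia.
- by move: deg_v; rewrite {1}vE mdegD deg_u; lia.
exists (fun j => if j == k then u else f j); split=> [j|].
  rewrite ltnS leq_eqVlt; case: eqP => [_ _|_ /= /f_gen //].
  by split=> // i; have := lub i; lia.
rewrite big_ord_recr /= eqxx {1}vE mpolyXD fE; congr (_ * _).
by apply: eq_bigr => j _; rewrite ltn_eqF.
Qed.

Lemma ideal_pow_veronese k :
  ideal_pow (veronese_type K d a) k = mnm_span K (vero k).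
Proof.
apply/seteqP; split.
  apply: (ideal_gen_sub_span (@vero_up k)) => _ [f [If ->]].
  have Vf i : mnm_span K (vero 1) (f i) by apply: veronese_sub.
  elim: k => [|k IHk] in f {If} Vf *.
    by rewrite big_ord0 -mpolyX0; apply/mnm_spanX.
  rewrite big_ord_recr /=; apply: mnm_spanM => m c.
  move: (IHk (fun i => f (widen_ord (leqnSn k) i)) (fun i => Vf _)) (Vf ord_max).
  by move=> /allP Vm /allP Vc /Vm + /Vc; apply: veroS.
apply: span_sub_ideal_gen => m Vm.
(* [v] is a divisor of [m] of degree exactly $kd$ with exponents at most $k a_i$. *)
have [|v [vb deg_v]] := @sum_interpolation n (fun=> 0%N)
    (fun i => minn (m i) (k * a i)) (k * d) (fun=> leq0n _).
  by rewrite big1 //=; exact: Vm.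
have [|f [f_gen fE]] := mnm_decomposition _ deg_v.
  by move=> i; have := vb i; lia.
have le_vm : (v <= m)%MM by apply/mnm_lepP => i; have := vb i; lia.
rewrite -(submK le_vm) mpolyXD; apply/ideal_genMl/ideal_gen_mem; exists (fun j : 'I_k => 'X_[f j]).
split=> // j; have [deg_f le_fa] := f_gen j (ltn_ord j).
by apply: ideal_gen_mem; exists (f j).
Qed.

(** * Associated primes of the powers *)

Lemma Ass_sub_Vstar k : (0 < k)%N ->
  Ass (ideal_pow (veronese_type K d a) k) `<=` Vstar (veronese_type K d a).
Proof.
move=> k_gt0 P [primeP [f PE]].
have PJ g : P g = mnm_span K (vero k) (g * f) by rewrite PE /colon /= ideal_pow_veronese.
have /prime_idealP[P0 P1 PD PM] := primeP.
split; last first.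
  move=> g /(@ideal_pow_exp _ _ k) Ig; apply: (prime_ideal_exp (k := k) primeP).
  by rewrite PJ mulrC; apply: mnm_spanMl (@vero_up k) _; rewrite -ideal_pow_veronese.
pose A := [set i : 'I_n | `[< P 'X_i >]]%SET.
have in_A i : i \in A = `[< P 'X_i >] by rewrite inE.
exists A; apply/seteqP; split; last first.
  move=> _ [s [As ->]]; rewrite big_seq; elim/big_ind: _ => //.
    by move=> g h Pg Ph; rewrite -[g]mul1r; apply: PD.
  move=> p /As [i]; rewrite in_A => /asboolP Pi ->.
  by rewrite -[X in P X]addr0; apply: PD.
move=> g Pg.
(* Multiplying [f] by [h], which is not in [P], makes membership in the power of
   the Veronese ideal independent of the exponents outside [A]. *)
pose h : 'X_{1..n} := [multinom if i \in A then 0 else k * a i | i < n]%N.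
have nPh : ~ P 'X_[h].
  move=> /(prime_idealXm primeP)[i]; rewrite mnmE in_A; case: asboolP => //.
have : mnm_span K (vero k) (g * ('X_[h] * f)).
  by rewrite mulrCA; apply: mnm_spanMl (@vero_up k) _; rewrite -PJ.
rewrite var_idealE; case/(mnm_span_prime (U := meets A) (V := vero k)) => //; last first.
  by rewrite -PJ => /nPh.
move=> m c _ cf; have [/exists_inP[i iA mi]|] := boolP (meets A m) => /=.
  (* Multiplication by a variable merges no terms, so each term of the product lies in the power. *)
  have : mnm_span K (vero k) ('X_i * ('X_[h] * f)).
    rewrite mulrCA; apply: mnm_spanMl (@vero_up k) _; rewrite -PJ.
    by apply/asboolP; rewrite -in_A.
  move=> /allP/(_ (U_(i) + c)%MM).
  rewrite mulrC (perm_mem (msuppMX _ _)) map_f // => /(_ isT).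
  by move=> VUc; rewrite -(submK (lem1m mi)) -addmA addmC; apply: vero_up.
(* Here [m] lives off [A], where [h] already reaches the caps $k a_i$, so adding [m] changes no
   truncated exponent. *)
rewrite negb_exists => /forallP nm.
move: cf; rewrite mulrC (perm_mem (msuppMX _ _)) => /mapP[c' _ ->].
rewrite /vero; congr (_ <= _)%N; apply: eq_bigr => i _; rewrite !mnmDE /h mnmE.
by have := nm i; case: (i \in A) => /=; lia.
Qed.

Lemma Vstar_sub_Ass k :
    (d < \sum_(i < n) a i)%N -> (forall i, 1 <= a i)%N -> (n < k)%N ->
  Vstar (veronese_type K d a) `<=` Ass (ideal_pow (veronese_type K d a) k).
Proof.
move=> d_lt a_ge1 lt_nk _ [[A ->] IA]; split; first exact: var_ideal_prime.
(* Otherwise some generator of $I$ would involve no variable of [A]. *)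
have sum_off : (\sum_(i < n) (if i \in A then 0 else a i) < d)%N.
  rewrite ltnNge; apply/negP => d_le.
  have [|m [mb deg_m]] := @sum_interpolation n (fun=> 0%N)
      (fun i => if i \in A then 0 else a i)%N d (fun=> leq0n _).
    by rewrite d_le big1.
  have : veronese_type K d a 'X_[m].
    apply: ideal_gen_mem; exists m; split=> // i.
    by have := mb i; case: ifP; lia.
  move=> /IA; rewrite var_idealE => /mnm_spanX /exists_inP[i iA].
  by have := mb i; rewrite iA; lia.
(* The colon ideal of the monomial with exponents [w] is the prime of [A]: off [A]
   the exponents are already saturated, on [A] there is room for one more, and the
   degree is one short. *)
have [||w [wb deg_w]] := @sum_interpolation n
    (fun i => if i \in A then 0 else k * a i)%N
    (fun i => if i \in A then (k * a i).-1 else k * a i)%N (k * d).-1.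
- by move=> i; case: ifP => _; lia.
- apply/andP; split.
    have -> : (\sum_(i < n) (if i \in A then 0 else k * a i) =
               k * \sum_(i < n) (if i \in A then 0 else a i))%N.
      by rewrite big_distrr /=; apply: eq_bigr => i _; case: ifP; rewrite ?muln0.
    by nia.
  (* Each variable of [A] lowers the upper bound by at most one, for a total loss of at most $n <
     k$; hence $k(d+1) - n > kd$. *)
  have : (k * d.+1 <=
      \sum_(i < n) (if i \in A then (k * a i).-1 else k * a i) + n)%N.
    apply: leq_trans (leq_mul (leqnn k) d_lt) _.
    rewrite -[X in (_ + X)%N]card_ord -sum1_card -big_split big_distrr /=.
    by apply: leq_sum => i _; case: ifP => _; lia.
  by rewrite mulnS /=; lia.
exists 'X_[w]; rewrite /colon ideal_pow_veronese var_idealE.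
apply/seteqP; split=> g.
  move=> /allP Ag; apply: mnm_spanM => m c /Ag /exists_inP[i iA mi].
  rewrite msuppX inE => /eqP ->.
  rewrite -(submK (lem1m mi)) -addmA addmC; apply: vero_up; rewrite /vero.
  (* The variable $x_i$ supplies the missing degree without exceeding the cap $k a_i$. *)
  have <- : mdeg (U_(i) + w) = (k * d)%N by rewrite mdegD mdeg1 deg_w; nia.
  rewrite mdegE; apply: leq_sum => j _; rewrite mnmDE mnm1E leq_min leqnn /=.
  by have := wb j; case: eqP => [<-|_]; rewrite ?iA; have := a_ge1 i; [nia|case: ifP; lia].
move=> /allP Jg; apply/allP => m mg; apply: contraT.
rewrite /meets negb_exists => /forallP nm.
have := Jg (w + m)%MM; rewrite (perm_mem (msuppMX _ _)) map_f // => /(_ isT).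
rewrite /vero leqNgt => /negP; case.
(* A monomial free of [A] only raises saturated exponents, so the truncated degree stays at most $kd
   - 1$. *)
suff : (\sum_i minn ((w + m)%MM i) (k * a i) <= mdeg w)%N.
  by rewrite deg_w; nia.
rewrite mdegE; apply: leq_sum => i _; rewrite mnmDE.
by have := nm i; have := wb i; case: ifP => iA /=; rewrite ?iA /=; lia.
Qed.

End VeronesePowers.

Theorem proposition4p3 (K : fieldType) (n d : nat) (a : 'I_n -> nat)
    (d_lt_sum : (d < \sum_(i < n) a i)%N)
    (d_gt1 : (1 < d)%N)
    (a_ge1 : forall i : 'I_n, (1 <= a i)%N) :
  is_Ass_infty (veronese_type K d a) (Vstar (veronese_type K d a)).
Proof.
(* The threshold is the bound $n < k$ of [Vstar_sub_Ass]. *)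
exists n.+1 => k lt_nk; apply/seteqP; split; last exact: Vstar_sub_Ass.
exact: Ass_sub_Vstar (leq_ltn_trans (leq0n n) lt_nk).
Qed.
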